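(* Let $G$ be a valid, ground GDL description in restricted form, decomposed as $G=G_L\cup G_N\cup G_E\cup G_R$, and let $R$ be its set of players. Suppose all of the following hold: (1) $G\cup S_{init}^{true}\not\models \mathit{terminal}$, and $|\gamma(p_i)|\ge 2$ for every $p_i\in R$; (2) for each $p_i\in R$ there is a state $S_i\subseteq\beta$ with $G\cup S_i^{true}\models \mathit{goal}(p_i,100)$ and $G\cup S_i^{true}\models\mathit{terminal}$; (3) $|G_L|+|G_E|\ge 2|R|$, $|G_N|+|G_E|\ge |\mathcal{N}|\cdot|R|$, and $|G_L|+|G_N|+|G_E|\ge (2+|\mathcal{N}|)\cdot|R|$. Then for every $n>0$ there exists a valid repair $\mathcal{R}$ on $G$ such that $rep(G,\mathcal{R})$ is $n$-well-formed.
   Context: GDL. A ground GDL description $G$ is a finite ground normal logic program using the reserved predicates $\mathit{role}(P)$, $\mathit{base}(F)$, $\mathit{input}(P,A)$, $\mathit{init}(F)$, $\mathit{true}(F)$, $\mathit{legal}(P,A)$, $\mathit{does}(P,A)$, $\mathit{next}(F)$, $\mathit{terminal}$, $\mathit{goal}(P,N)$ and possibly auxiliary predicates. $G$ is valid if: $\mathit{role}$ occurs only in facts; $\mathit{init}$ and $\mathit{next}$ occur only in rule heads; $\mathit{true}$ and $\mathit{does}$ occur only in rule bodies; $\mathit{init}$ does not depend on $\mathit{true},\mathit{does},\mathit{legal},\mathit{next},\mathit{terminal},\mathit{goal}$; $\mathit{legal},\mathit{terminal},\mathit{goal}$ do not depend on $\mathit{does}$; and $G$ is stratified and allowed, so that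 $G$ together with any set of facts has a unique stable model; $P\models q$ means $q$ belongs to the unique stable model of $P$. Let $\beta=\{f: G\models \mathit{base}(f)\}$ (base propositions), $\gamma=\{(p,a): G\models\mathit{input}(p,a)\}$ (move domain), $\gamma(p)=\{a:(p,a)\in\gamma\}$, $R=\{p: G\models\mathit{role}(p)\}$. A state is a set $S\subseteq\beta$, encoded as facts $S^{true}=\{\mathit{true}(f).: f\in S\}$; a joint action $A$ assigns each player an action, encoded as $A^{does}=\{\mathit{does}(p,A(p)).: p\in R\}$. Initial state $S_{init}=\{f\in\beta: G\models\mathit{init}(f)\}$; terminal states $T=\{S: G\cup S^{true}\models\mathit{terminal}\}$; $a$ is legal for $p$ in $S$ iff $G\cup S^{true}\models\mathit{legal}(p,a)$; successor $u(A,S)=\{f\in\beta: G\cup S^{true}\cup A^{does}\models\mathit{next}(f)\}$. $B$ is the set of states in which some player $p\in R$ has no legal $a\in\gamma(p)$. A valid sequence $(S_0,\dots,S_m)$ has $S_0=S_{init}$, $S_{i+1}=u(A_i,S_i)$ for joint actions $A_i$ in which every player's action is legal in $S_i$, and $S_i\notin T$ for $i<m$. It terminates if $S_m\in T$ and ends in a non-playable state if $S_m\in B\setminus T$. It is $n$-max if $m=n$, or $m<n$ and $S_m\in T\cup B$. The horizon of $G$ is the smallest $n$ such that every $n$-max sequence terminates, ends in a non-playable state, or has $S_m$ equal to an earlier state of the sequence. $G$ is well-formed if (i) for each $p\in R$ there is a terminating valid sequence $(S_{init},\dots,S_m)$ with $G\cup S_m^{true}\models\mathit{goal}(p,100)$;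 (ii) no valid sequence ends in a non-playable state; (iii) all valid (play) sequences terminate. $G$ is $n$-well-formed if it is well-formed and its horizon is at most $n$. Restricted form and repairs. Let $\mathcal{N}=\{\mathit{next}(f):f\in\beta\}$, $\mathcal{L}=\{\mathit{legal}(p,a):(p,a)\in\gamma\}$, $\mathcal{F}=\{\mathit{true}(f),\ \mathit{not}\ \mathit{true}(f): f\in\beta\}$, $\mathcal{A}=\{\mathit{does}(p,a),\ \mathit{not}\ \mathit{does}(p,a):(p,a)\in\gamma\}$; $hd(r)$ is the head atom and $bd(r)$ the set of body literals of a ground rule $r$. $G$ is in restricted form if for every rule $r$: $\mathit{legal}$ does not occur in $bd(r)$; $\mathit{does}$ occurs in $bd(r)$ only if $hd(r)\in\mathcal{N}$; if $hd(r)\in\mathcal{L}$ (legal rule) then $bd(r)\subseteq\mathcal{F}$; if $hd(r)\in\mathcal{N}$ (next rule) then $bd(r)\subseteq\mathcal{A}\cup\mathcal{F}$. Such $G$ is written $G=G_L\cup G_N\cup G_E\cup G_R$ where $G_L$ are the legal rules, $G_N$ the next rules, $G_E$ a fixed number of placeholder rules with head the special symbol $\emptyset$ and empty body, and $G_R$ all other rules. Let $G_C=G_L\cup G_N\cup G_E$, numbered $r_1,\dots,r_{|G_C|}$ with indices of $G_L$ smaller than those of $G_N$, smaller than those of $G_E$; $\mathcal{I}=\{1,\dots,|G_C|\}$. Let $Dom=(\{c\}\times(\{\emptyset\}\cup\mathcal{L}\cup\mathcal{N}))\cup(\{+,-\}\times(\mathcal{A}\cup\mathcal{F}))$. A change tuple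 is $\langle i,(tp,l)\rangle\in\mathcal{I}\times Dom$; a repair $\mathcal{R}$ is a set of change tuples. With $L_i^+=\{l:\langle i,(+,l)\rangle\in\mathcal{R}\}$ and $L_i^-=\{l:\langle i,(-,l)\rangle\in\mathcal{R}\}$, $\mathcal{R}$ is valid iff for all $i$: (a) at most one $h$ with $\langle i,(c,h)\rangle\in\mathcal{R}$; (b) $L_i^+\subseteq(\mathcal{A}\cup\mathcal{F})\setminus bd(r_i)$ and $L_i^-\subseteq bd(r_i)$; (c) if $r_i\in G_L$ and $\langle i,(c,h)\rangle\in\mathcal{R}$ then $h\in\{\emptyset\}\cup\mathcal{L}$; (d) if $r_i\in G_N$ and $\langle i,(c,h)\rangle\in\mathcal{R}$ then $h\in\{\emptyset\}\cup\mathcal{N}$; (e) if $hd(r_i)\in\mathcal{L}$ or $\langle i,(c,h)\rangle\in\mathcal{R}$ for some $h\in\mathcal{L}$, then $L_i^+\subseteq\mathcal{F}$. For valid $\mathcal{R}$, $rep(G,\mathcal{R})=\{r'_1,\dots,r'_{|G_C|}\}\cup G_R$ where $hd(r'_i)=h$ if $\langle i,(c,h)\rangle\in\mathcal{R}$ and $hd(r'_i)=hd(r_i)$ otherwise, and $bd(r'_i)=(bd(r_i)\cup L_i^+)\setminus L_i^-$ if $hd(r'_i)\neq\emptyset$, else $bd(r'_i)=\{\}$ (rules with head $\emptyset$ are inert placeholders).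
   Formalization: The formal statement additionally assumes that the set of players R is nonempty; without it the claim fails (for the empty description, (1)–(3) hold, only the empty repair exists, and the play never terminates). *)

(* Defs.v *)
From HB Require Import structures.
From Stdlib Require Relation_Operators.
From mathcomp Require Import all_boot finmap.
From mathcomp Require Import boolp classical_sets cardinality.

Set Implicit Arguments.
Unset Strict Implicit.
Unset Printing Implicit Defensive.

Local Open Scope fset_scope.
Local Open Scope classical_set_scope.

(* T is the type of ground terms, Q the type of auxiliary predicate symbols. *)
Inductive atom (T Q : Type) : Type :=
| ARole of T
| ABase of T
| AInput of T & T
| AInit of T
| ATrue of T
| ALegal of T & T
| ADoes of T & T
| ANext of T
| ATerminal
| AGoal of T & nat
| AAux of Q & seq T.

Arguments ARole {T Q}.
Arguments ABase {T Q}.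
Arguments AInput {T Q}.
Arguments AInit {T Q}.
Arguments ATrue {T Q}.
Arguments ALegal {T Q}.
Arguments ADoes {T Q}.
Arguments ANext {T Q}.
Arguments ATerminal {T Q}.
Arguments AGoal {T Q}.
Arguments AAux {T Q}.

Inductive pred_symbol (Q : Type) : Type :=
| PRole | PBase | PInput | PInit | PTrue | PLegal | PDoes | PNext
| PTerminal | PGoal | PAux of Q.

Arguments PRole {Q}.
Arguments PBase {Q}.
Arguments PInput {Q}.
Arguments PInit {Q}.
Arguments PTrue {Q}.
Arguments PLegal {Q}.
Arguments PDoes {Q}.
Arguments PNext {Q}.
Arguments PTerminal {Q}.
Arguments PGoal {Q}.

Section AtomChoice.
Variables T Q : choiceType.

Definition atom_encode (a : atom T Q) : nat * seq T * nat * option Q :=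
  match a with
  | ARole p => (0, [:: p], 0, None)
  | ABase f => (1, [:: f], 0, None)
  | AInput p b => (2, [:: p; b], 0, None)
  | AInit f => (3, [:: f], 0, None)
  | ATrue f => (4, [:: f], 0, None)
  | ALegal p b => (5, [:: p; b], 0, None)
  | ADoes p b => (6, [:: p; b], 0, None)
  | ANext f => (7, [:: f], 0, None)
  | ATerminal => (8, [::], 0, None)
  | AGoal p n => (9, [:: p], n, None)
  | AAux q ts => (10, ts, 0, Some q)
  end.

Definition atom_decode (c : nat * seq T * nat * option Q) : option (atom T Q) :=
  match c with
  | (0, [:: p], _, _) => Some (ARole p)
  | (1, [:: f], _, _) => Some (ABase f)
  | (2, [:: p; b], _, _) => Some (AInput p b)
  | (3, [:: f], _, _) => Some (AInit f)
  | (4, [:: f], _, _) => Some (ATrue f)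
  | (5, [:: p; b], _, _) => Some (ALegal p b)
  | (6, [:: p; b], _, _) => Some (ADoes p b)
  | (7, [:: f], _, _) => Some (ANext f)
  | (8, [::], _, _) => Some ATerminal
  | (9, [:: p], n, _) => Some (AGoal p n)
  | (10, ts, _, Some q) => Some (AAux q ts)
  | _ => None
  end.

Lemma atom_encodeK : pcancel atom_encode atom_decode.
Proof. by case. Qed.

HB.instance Definition _ := Choice.copy (atom T Q) (pcan_type atom_encodeK).
End AtomChoice.

Inductive literal (T Q : Type) : Type :=
| Pos of atom T Q
| Neg of atom T Q.

Arguments Pos {T Q}.
Arguments Neg {T Q}.

Definition lit_atom (T Q : Type) (l : literal T Q) : atom T Q :=
  match l with Pos a | Neg a => a end.

Section LiteralChoice.
Variables T Q : choiceType.

Definition lit_encode (l : literal T Q) : bool * atom T Q :=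
  match l with Pos a => (true, a) | Neg a => (false, a) end.

Definition lit_decode (c : bool * atom T Q) : literal T Q :=
  if c.1 then Pos c.2 else Neg c.2.

Lemma lit_encodeK : cancel lit_encode lit_decode.
Proof. by case. Qed.

HB.instance Definition _ := Choice.copy (literal T Q) (can_type lit_encodeK).
End LiteralChoice.

(* The head [None] is the special symbol ∅. *)
Definition rule (T Q : choiceType) : Type :=
  (option (atom T Q) * {fset literal T Q})%type.

Section GDL.
Variables T Q : choiceType.
Local Notation atom := (atom T Q).
Local Notation literal := (literal T Q).
Local Notation rule := (rule T Q).
Local Notation pred_symbol := (pred_symbol Q).
Implicit Types (G : seq rule) (P : set rule) (M : set atom) (S : set T).

Definition hd (r : rule) : option atom := r.1.
Definition bd (r : rule) : {fset literal} := r.2.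

Definition fact (a : atom) : rule := (Some a, fset0).

(* [N] is closed under the rules of the Gelfond-Lifschitz reduct of [P] with
   respect to [M]. A rule with head ∅ is inert (it is not a constraint). *)
Definition reduct_model P M (N : set atom) : Prop :=
  forall r h, P r -> hd r = Some h ->
    (forall a, Neg a \in bd r -> ~ M a) ->
    (forall a, Pos a \in bd r -> N a) -> N h.

Definition stable_model P M : Prop :=
  reduct_model P M M /\ forall N, reduct_model P M N -> M `<=` N.

Definition entails P (q : atom) : Prop :=
  exists M, [/\ stable_model P M,
                forall M', stable_model P M' -> M' = M & M q].

Definition pred_of (a : atom) : pred_symbol :=
  match a with
  | ARole _ => PRole
  | ABase _ => PBase
  | AInput _ _ => PInput
  | AInit _ => PInit
  | ATrue _ => PTrue
  | ALegal _ _ => PLegal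
  | ADoes _ _ => PDoes
  | ANext _ => PNext
  | ATerminal => PTerminal
  | AGoal _ _ => PGoal
  | AAux q _ => PAux q
  end.

Definition occurs_in_head (x : pred_symbol) (r : rule) : Prop :=
  exists2 h, hd r = Some h & pred_of h = x.

Definition occurs_in_body (x : pred_symbol) (r : rule) : Prop :=
  exists2 l, l \in bd r & pred_of (lit_atom l) = x.

Definition depends_directly G (x y : pred_symbol) : Prop :=
  exists2 r, r \in G & occurs_in_head x r /\ occurs_in_body y r.

Definition depends G : pred_symbol -> pred_symbol -> Prop :=
  Relation_Operators.clos_trans _ (depends_directly G).

(* Stratification is at the level of predicate symbols. *)
Definition stratified G : Prop :=
  exists stratum : pred_symbol -> nat,
    forall r h, r \in G -> hd r = Some h ->
      (forall a, Pos a \in bd r ->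
         (stratum (pred_of a) <= stratum (pred_of h))%N) /\
      (forall a, Neg a \in bd r ->
         (stratum (pred_of a) < stratum (pred_of h))%N).

(* Allowedness constrains the variables of a rule, so it is vacuous here. *)
Record valid_gdl G : Prop := {
  valid_role : forall r, r \in G ->
    occurs_in_head PRole r \/ occurs_in_body PRole r -> bd r = fset0;
  valid_init_next : forall r, r \in G ->
    ~ occurs_in_body PInit r /\ ~ occurs_in_body PNext r;
  valid_true_does : forall r, r \in G ->
    ~ occurs_in_head PTrue r /\ ~ occurs_in_head PDoes r;
  valid_init : [/\ ~ depends G PInit PTrue, ~ depends G PInit PDoes,
                   ~ depends G PInit PLegal, ~ depends G PInit PNext &
                   ~ depends G PInit PTerminal /\ ~ depends G PInit PGoal];
  valid_no_does : [/\ ~ depends G PLegal PDoes, ~ depends G PTerminal PDoes &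
                      ~ depends G PGoal PDoes];
  valid_stratified : stratified G
}.

Definition base_props G : set T := [set f | entails [set` G] (ABase f)].
Definition move_domain G (p : T) : set T :=
  [set a | entails [set` G] (AInput p a)].
Definition players G : set T := [set p | entails [set` G] (ARole p)].

Definition true_facts S : set rule := [set fact (ATrue f) | f in S].

(* Only the values of a joint action on the players matter. *)
Definition does_facts G (A : T -> T) : set rule :=
  [set fact (ADoes p (A p)) | p in players G].

Definition holds_in G S (q : atom) : Prop :=
  entails ([set` G] `|` true_facts S) q.

Definition is_state G S : Prop := (S `<=` base_props G).

Definition init_state G : set T :=
  [set f | base_props G f /\ entails [set` G] (AInit f)].

Definition terminal_states G : set (set T) :=
  [set S | is_state G S /\ holds_in G S ATerminal].

Definition legal_in G S (p a : T) : Prop := holds_in G S (ALegal p a).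

Definition update G (A : T -> T) S : set T :=
  [set f | base_props G f /\
     entails ([set` G] `|` true_facts S `|` does_facts G A) (ANext f)].

Definition non_playable_states G : set (set T) :=
  [set S | is_state G S /\
     exists2 p, players G p & forall a, move_domain G p a -> ~ legal_in G S p a].

(* The sequence is [(s 0, ..., s m)]; the values of [s] beyond [m] are junk. *)
Definition valid_sequence G (m : nat) (s : nat -> set T) : Prop :=
  s 0%N = init_state G /\
  forall i, (i < m)%N ->
    ~ terminal_states G (s i) /\
    exists2 A : T -> T, forall p, players G p -> legal_in G (s i) p (A p)
      & s i.+1 = update G A (s i).

Definition terminates G (m : nat) (s : nat -> set T) : Prop :=
  terminal_states G (s m).

Definition ends_non_playable G (m : nat) (s : nat -> set T) : Prop :=
  non_playable_states G (s m) /\ ~ terminal_states G (s m).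

Definition max_sequence G (n m : nat) (s : nat -> set T) : Prop :=
  valid_sequence G m s /\
  (m = n \/ (m < n)%N /\ (terminal_states G (s m) \/ non_playable_states G (s m))).

Definition horizon_bound G (n : nat) : Prop :=
  forall m s, max_sequence G n m s ->
    [\/ terminates G m s, ends_non_playable G m s
      | exists2 i, (i < m)%N & s i = s m].

Definition is_horizon G (n : nat) : Prop :=
  horizon_bound G n /\ forall k, horizon_bound G k -> (n <= k)%N.

(* A play is a valid sequence that is infinite or cannot be extended. *)
Definition infinite_play G (s : nat -> set T) : Prop :=
  forall m, valid_sequence G m s.

Definition finite_play G (m : nat) (s : nat -> set T) : Prop :=
  valid_sequence G m s /\
  ~ exists s', valid_sequence G m.+1 s' /\ forall i, (i <= m)%N -> s' i = s i.

Record well_formed G : Prop := {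
  wf_winnable : forall p, players G p ->
    exists m s, [/\ valid_sequence G m s, terminates G m s &
                    holds_in G (s m) (AGoal p 100)];
  wf_playable : forall m s, valid_sequence G m s -> ~ ends_non_playable G m s;
  wf_terminating : (forall s, ~ infinite_play G s) /\
    (forall m s, finite_play G m s -> terminates G m s)
}.

Definition n_well_formed (n : nat) G : Prop :=
  well_formed G /\ exists2 h, is_horizon G h & (h <= n)%N.

Definition next_atoms G : set atom := [set ANext f | f in base_props G].

Definition legal_atoms G : set atom :=
  [set x | exists p a, move_domain G p a /\ x = ALegal p a].

Definition state_literals G : set literal :=
  [set l | exists2 f, base_props G f & l = Pos (ATrue f) \/ l = Neg (ATrue f)].

Definition action_literals G : set literal :=
  [set l | exists p a, move_domain G p a /\
                       (l = Pos (ADoes p a) \/ l = Neg (ADoes p a))].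

Definition has_head_in (r : rule) (H : set atom) : Prop :=
  exists2 h, hd r = Some h & H h.

Record restricted_form G : Prop := {
  restricted_no_legal : forall r, r \in G -> ~ occurs_in_body PLegal r;
  restricted_does : forall r, r \in G ->
    occurs_in_body PDoes r -> has_head_in r (next_atoms G);
  restricted_legal_rule : forall r, r \in G ->
    has_head_in r (legal_atoms G) ->
    forall l, l \in bd r -> state_literals G l;
  restricted_next_rule : forall r, r \in G ->
    has_head_in r (next_atoms G) ->
    forall l, l \in bd r -> action_literals G l \/ state_literals G l
}.

(* G_L, G_N and G_R are listed without repetition (see [is_decomposition]);
   the placeholders of G_E are identical, so G_E is given by their number. *)
Record decomposition := Decomposition {
  GL : seq rule;
  GN : seq rule;
  placeholders : nat;
  GR : seq rule
}.

Definition GE (D : decomposition) : seq rule :=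
  nseq (placeholders D) (None, fset0).

Definition GC (D : decomposition) : seq rule := GL D ++ GN D ++ GE D.

Definition program (D : decomposition) : seq rule := GC D ++ GR D.

Record is_decomposition (D : decomposition) : Prop := {
  decomposition_uniq : [/\ uniq (GL D), uniq (GN D) & uniq (GR D)];
  decomposition_GL : forall r, r \in GL D ->
    has_head_in r (legal_atoms (program D));
  decomposition_GN : forall r, r \in GN D ->
    has_head_in r (next_atoms (program D));
  decomposition_GR : forall r, r \in GR D ->
    [/\ hd r <> None, ~ has_head_in r (legal_atoms (program D)) &
        ~ has_head_in r (next_atoms (program D))]
}.

(* The second components (c, h), (+, l) and (-, l) of change tuples. *)
Inductive change : Type :=
| ChangeHead of option atom
| AddLit of literal
| DelLit of literal.

Definition change_encode (c : change) : option atom + (literal + literal) :=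
  match c with
  | ChangeHead h => inl h
  | AddLit l => inr (inl l)
  | DelLit l => inr (inr l)
  end.

Definition change_decode (c : option atom + (literal + literal)) : change :=
  match c with
  | inl h => ChangeHead h
  | inr (inl l) => AddLit l
  | inr (inr l) => DelLit l
  end.

Lemma change_encodeK : cancel change_encode change_decode.
Proof. by case. Qed.

HB.instance Definition _ := Choice.copy change (can_type change_encodeK).

(* Rules of G_C are numbered from 0. *)
Definition change_set (D : decomposition) : Type :=
  {fset 'I_(size (GC D)) * change}.

Section Repair.
Variables (D : decomposition) (X : change_set D).
Local Notation G := (program D).
Implicit Types i : 'I_(size (GC D)).

Definition rule_at i : rule := tnth (in_tuple (GC D)) i.

Definition head_changes i : seq (option atom) :=
  pmap (fun t => if t.2 is ChangeHead h then
                   if t.1 == i then Some h else None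
                 else None) (enum_fset X).

Definition added i : {fset literal} :=
  [fset l in pmap (fun t => if t.2 is AddLit l then
                              if t.1 == i then Some l else None
                            else None) (enum_fset X)].

Definition deleted i : {fset literal} :=
  [fset l in pmap (fun t => if t.2 is DelLit l then
                              if t.1 == i then Some l else None
                            else None) (enum_fset X)].

Definition in_dom (c : change) : Prop :=
  match c with
  | ChangeHead None => True
  | ChangeHead (Some h) => legal_atoms G h \/ next_atoms G h
  | AddLit l | DelLit l => action_literals G l \/ state_literals G l
  end.

Definition is_repair : Prop := forall i c, (i, c) \in X -> in_dom c.

Record valid_repair : Prop := {
  repair_dom : is_repair;
  repair_head_unique : forall i h h',
    (i, ChangeHead h) \in X -> (i, ChangeHead h') \in X -> h = h';
  repair_added : forall i l, l \in added i ->
    (action_literals G l \/ state_literals G l) /\ l \notin bd (rule_at i);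
  repair_deleted : forall i l, l \in deleted i -> l \in bd (rule_at i);
  repair_GL : forall i h, rule_at i \in GL D ->
    (i, ChangeHead (Some h)) \in X -> legal_atoms G h;
  repair_GN : forall i h, rule_at i \in GN D ->
    (i, ChangeHead (Some h)) \in X -> next_atoms G h;
  repair_legal : forall i,
    has_head_in (rule_at i) (legal_atoms G) \/
    (exists2 h, (i, ChangeHead (Some h)) \in X & legal_atoms G h) ->
    forall l, l \in added i -> state_literals G l
}.

Definition repaired_head i : option atom :=
  head (hd (rule_at i)) (head_changes i).

Definition repaired_rule i : rule :=
  (repaired_head i,
   if repaired_head i is None then fset0
   else ((bd (rule_at i) `|` added i) `\` deleted i)%fset).

Definition rep : seq rule :=
  [seq repaired_rule i | i <- enum 'I_(size (GC D))] ++ GR D.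

End Repair.
End GDL.

(* Main.v *)
(* The repaired game lasts one round. Every player p gets two legal moves a0 p
   and a1 p in all states; the winner of a round is the first player, in a fixed
   enumeration, who plays a1, and the last player if nobody does. This condition
   is a conjunction of does-literals, so it can guard rules that set the next
   state to a terminal state W p in which the winner p has goal value 100. Since
   legal and next never occur in bodies, changing their rules does not affect
   the truth of the other atoms (splitting of stable models); in particular the
   initial state stays non-terminal and each W p stays terminal. *)

Require Import Defs.
From mathcomp Require Import all_boot finmap.
From mathcomp Require Import boolp classical_sets cardinality.
From mathcomp Require Import zify.

Local Open Scope fset_scope.
Local Open Scope classical_set_scope.
Local Open Scope nat_scope.

Set Implicit Arguments.
Unset Strict Implicit.
Unset Printing Implicit Defensive.

(** * Stable models of stratified programs: existence, uniqueness, splitting *)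

Section StableModels.
Context {T Q : choiceType}.
Local Notation atom := (atom T Q).
Local Notation rule := (rule T Q).
Implicit Types (P : set rule) (M N X Y B : set atom) (lev : atom -> nat).

(** This is the least model of the Gelfond-Lifschitz reduct with respect to [X], taken as an
    intersection of models. Stable models are the fixed points of [closure P]. *)
Definition closure P X : set atom :=
  [set a | forall N, reduct_model P X N -> N a].

Lemma closure_reduct P X : reduct_model P X (closure P X).
Proof.
move=> r h Pr hr neg pos N XN.
by apply: (XN r h) => // a /pos; exact.
Qed.

Lemma stable_closure P M : stable_model P M <-> M = closure P M.
Proof.
split=> [[MM least]|eqM].
  by apply/seteqP; split=> a; [move=> Ma N /least; exact | exact].
split; first by have := @closure_reduct P M; rewrite -eqM.
by move=> N NM a; rewrite [M in M a]eqM; exact.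
Qed.

(** The atoms of the closure that have a supporting rule already form a model of the reduct, so
    leastness puts every atom of the closure among them. *)
Lemma closure_supported P X a : closure P X a ->
  exists r, [/\ P r, hd r = Some a, forall b, Neg b \in bd r -> ~ X b &
                forall b, Pos b \in bd r -> closure P X b].
Proof.
pose N := [set b | closure P X b /\
  exists r, [/\ P r, hd r = Some b, forall c, Neg c \in bd r -> ~ X c &
                forall c, Pos c \in bd r -> closure P X c]].
suff NX : reduct_model P X N by move=> /(_ N NX)[].
move=> r h Pr hr neg pos; have posC b : Pos b \in bd r -> closure P X b.
  by move=> /pos[].
by split; [exact: (@closure_reduct P X r) | exists r].
Qed.

Lemma stable_supported P M a : stable_model P M -> M a ->
  exists r, [/\ P r, hd r = Some a, forall b, Neg b \in bd r -> ~ M b &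
                forall b, Pos b \in bd r -> M b].
Proof.
by move=> /stable_closure eqM; rewrite [M in M a]eqM => /closure_supported;
  rewrite -eqM.
Qed.

Definition stratified_by lev P : Prop :=
  forall r h, P r -> hd r = Some h ->
    (forall a, Pos a \in bd r -> lev a <= lev h) /\
    (forall a, Neg a \in bd r -> lev a < lev h).

(* [B] plays the role of a splitting set: the two programs may differ on the
   rules whose head lies outside [B]. *)
Lemma closure_agree lev P P' B X Y n :
  stratified_by lev P ->
  (forall r h, P r -> hd r = Some h -> B h ->
     P' r /\ forall l, l \in bd r -> B (lit_atom l)) ->
  (forall a, B a -> lev a < n -> Y a -> X a) ->
  forall a, B a -> lev a <= n -> closure P X a -> closure P' Y a.
Proof.
move=> strP PP' YX a Ba an.
(* Atoms outside [B] or above level [n] lie in this test model for free, so only rules with head in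
   [B] need a check, and these belong to [P'] as well. *)
move=> /(_ [set b | B b -> lev b <= n -> closure P' Y b]); apply=> //.
move=> r h Pr hr neg pos Bh hn.
have [P'r Bbd] := PP' r h Pr hr Bh; have [lep lt] := strP r h Pr hr.
apply: (@closure_reduct P' Y r) => // b br.
  move=> Yb; apply: (neg b br); apply: YX => //; first exact: Bbd br.
  exact: leq_trans (lt b br) hn.
by apply: pos => //; [exact: Bbd br | exact: leq_trans (lep b br) hn].
Qed.

(** Induction on levels: the negative literals in the body of a rule only look at strictly lower
    levels, where the two models already agree, so [closure_agree] applies in both directions. *)
Lemma stable_agree lev P P' B M M' :
  stratified_by lev P -> stratified_by lev P' ->
  (forall r h, hd r = Some h -> B h -> P r <-> P' r) ->
  (forall r h, P r -> hd r = Some h -> B h ->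
     forall l, l \in bd r -> B (lit_atom l)) ->
  stable_model P M -> stable_model P' M' ->
  forall a, B a -> M a <-> M' a.
Proof.
move=> strP strP' eqP Bbd /stable_closure eM /stable_closure eM'.
suff agree n a : B a -> lev a < n -> M a <-> M' a.
  by move=> a Ba; exact: (agree (lev a).+1).
elim: n a => // n IH a Ba an; rewrite eM eM'; split.
  apply: (closure_agree strP _ _ Ba an) => // [r h Pr hr Bh|b Bb bn].
    by split; [exact/(eqP r h) | exact: Bbd Bh].
  by apply: (IH b Bb bn).2.
apply: (closure_agree strP' _ _ Ba an) => // [r h P'r hr Bh|b Bb bn].
  have Pr : P r by exact/(eqP r h).
  by split; [| exact: Bbd Bh].
by apply: (IH b Bb bn).1.
Qed.

Lemma stable_unique lev P M M' : stratified_by lev P ->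
  stable_model P M -> stable_model P M' -> M' = M.
Proof.
move=> strP sM sM'; have agree a : M a <-> M' a.
  exact: (@stable_agree lev P P setT).
by apply/seteqP; split=> a /agree.
Qed.

(** The operator [closure P] is antitone, so its iterates from the empty set may oscillate; but an
    atom of level below [n] keeps its value from stage [n] on. The model reads each atom at a stage
    where its value is final. *)
Lemma stable_exists lev P : stratified_by lev P -> exists M, stable_model P M.
Proof.
move=> strP; pose stage n := iter n (closure P) set0.
have stageS n j k a : n <= j -> n <= k -> lev a < n -> stage j a -> stage k a.
  elim: n j k a => // n IH [//|j] [//|k] a nj nk an.
  apply: (@closure_agree lev P P setT (stage j) (stage k) n) => //.
  by move=> b _ bn; exact: IH.
exists [set a | stage (lev a).+1 a]; apply/stable_closure/seteqP.
split=> a /= Ca.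
  apply: (@closure_agree lev P P setT (stage (lev a)) _ (lev a)) Ca => //.
  by move=> b _ ba; exact: (stageS _ (lev b).+1 (lev a) b (leqnn _)).
apply: (@closure_agree lev P P setT [set b | stage (lev b).+1 b] _ (lev a)) Ca => //.
by move=> b _ ba; exact: (stageS _ (lev a) (lev b).+1 b ba (leqnn _)).
Qed.

(** Stratification makes the uniqueness clause of [entails] automatic, so any stable model at hand
    decides entailment. *)
Lemma entailsE lev P M q : stratified_by lev P -> stable_model P M ->
  entails P q <-> M q.
Proof.
move=> strP sM; split=> [[M' [sM' _ M'q]]|Mq].
  by rewrite -(stable_unique strP sM sM').
by exists M; split=> // M' sM'; exact: stable_unique strP sM sM'.
Qed.

Lemma entails_agree lev P P' B q :
  stratified_by lev P -> stratified_by lev P' ->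
  (forall r h, hd r = Some h -> B h -> P r <-> P' r) ->
  (forall r h, P r -> hd r = Some h -> B h ->
     forall l, l \in bd r -> B (lit_atom l)) ->
  B q -> entails P q <-> entails P' q.
Proof.
move=> strP strP' eqP Bbd Bq.
have [M sM] := stable_exists strP; have [M' sM'] := stable_exists strP'.
rewrite (entailsE q strP sM) (entailsE q strP' sM').
exact: (stable_agree strP strP' eqP Bbd sM sM').
Qed.

End StableModels.

(** * Finiteness of the sets of players, moves and next atoms *)

Section Descriptions.
Context {T Q : choiceType}.
Local Notation atom := (atom T Q).
Local Notation rule := (rule T Q).
Implicit Types (P : set rule) (G : seq rule).

Lemma entails_head P q : entails P q -> exists2 r, P r & hd r = Some q.
Proof. by case=> M [sM _ /(stable_supported sM)[r [Pr hr _ _]]]; exists r. Qed.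

(** An entailed atom heads some rule, and a program has finitely many rules. *)
Lemma finite_entailed G (g : T -> atom) : injective g ->
  finite_set [set x | entails [set` G] (g x)].
Proof.
move=> g_inj; apply: (@sub_finite_set _ _
  (g @^-1` [set` pmap (@hd T Q) G])).
  move=> x /= /entails_head[r rG hr].
  by rewrite mem_pmap -hr map_f.
by apply: finite_preimage; [move=> x y _ _; exact: g_inj | exact: finite_seq].
Qed.

Lemma finite_players G : finite_set (players G).
Proof. by apply: finite_entailed => x y []. Qed.

Lemma finite_move_domain G p : finite_set (move_domain G p).
Proof. by apply: finite_entailed => x y []. Qed.

Lemma finite_next_atoms G : finite_set (next_atoms G).
Proof. by apply: finite_image; apply: finite_entailed => x y []. Qed.

End Descriptions.

Lemma two_elements (K : choiceType) (A : set K) : finite_set A ->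
  2 <= #|` fset_set A| -> exists a b, [/\ A a, A b & a <> b].
Proof.
move=> finA.
case eqs: (enum_fset (fset_set A)) => [|a [|b s]]; rewrite ?eqs //= => _.
have mem x : x \in [:: a, b & s] -> A x.
  by rewrite -eqs => xA; have := in_fset_set finA x; rewrite xA => /esym/set_mem.
exists a, b; split; [by apply: mem; rewrite !inE eqxx
             | by apply: mem; rewrite !inE eqxx orbT |].
by move=> eqab; have := fset_uniq (fset_set A); rewrite eqs eqab /= inE eqxx.
Qed.

(** * Repairs that rewrite [GC D] position by position into a prescribed list *)

Section Retarget.
Context {T Q : choiceType}.
Local Notation atom := (atom T Q).
Local Notation rule := (rule T Q).
Variable D : decomposition T Q.
Local Notation G := (program D).

Definition blank : rule := (None, fset0).

Definition pad (n : nat) (s : seq rule) : seq rule :=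
  take n s ++ nseq (n - size s) blank.

Lemma size_pad n s : size (pad n s) = n.
Proof. by rewrite size_cat size_nseq size_take_min; lia. Qed.

Lemma mem_pad n s r : r \in pad n s -> r \in s \/ r = blank.
Proof.
rewrite mem_cat => /orP[/mem_take|]; first by left.
by rewrite mem_nseq => /andP[_ /eqP]; right.
Qed.

(* The rules in excess in [ls] and [ns] go to the placeholders. *)
Definition target (ls ns : seq rule) : seq rule :=
  pad (size (GL D)) ls ++ pad (size (GN D)) ns ++
  pad (size (GE D)) (drop (size (GL D)) ls ++ drop (size (GN D)) ns).

Lemma size_target ls ns : size (target ls ns) = size (GC D).
Proof. by rewrite /target /GC 2!size_cat !size_pad !size_cat. Qed.

Lemma mem_target ls ns r : r \in target ls ns ->
  [\/ r \in ls, r \in ns | r = blank].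
Proof.
rewrite mem_cat => /orP[/mem_pad[]|]; [by constructor 1|by constructor 3|].
rewrite mem_cat => /orP[/mem_pad[]|/mem_pad[]];
  [by constructor 2|by constructor 3| |by constructor 3].
by rewrite mem_cat => /orP[] /mem_drop; [constructor 1|constructor 2].
Qed.

Lemma sub_target ls ns r :
  size ls <= size (GL D) + size (GE D) -> size ns <= size (GN D) + size (GE D) ->
  size ls + size ns <= size (GL D) + size (GN D) + size (GE D) ->
  r \in ls ++ ns -> r \in target ls ns.
Proof.
move=> lsz nsz sz; rewrite /target /pad [take (size (GE D)) _]take_oversize;
  last by rewrite size_cat !size_drop; move: lsz nsz sz;
    move: (size ls) (size ns) (size (GL D)) (size (GN D)) (size (GE D)); lia.
rewrite mem_cat -{1}(cat_take_drop (size (GL D)) ls).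
rewrite -{1}(cat_take_drop (size (GN D)) ns) !mem_cat.
by do ![case/orP] => ->; rewrite ?orbT.
Qed.

(** The blocks of [target] are aligned with those of [GC], so a legal rule never has to become a
    next rule or conversely, as a valid repair demands; a placeholder may become either. *)
Lemma nth_target ls ns i : i < size (GC D) ->
  let t := nth blank (target ls ns) i in let r := nth blank (GC D) i in
  [\/ r \in GL D /\ (t \in ls \/ t = blank),
      r \in GN D /\ (t \in ns \/ t = blank) | r = blank].
Proof.
have nth3 (s1 s2 s3 : seq rule) : nth blank (s1 ++ s2 ++ s3) i =
    if i < size s1 then nth blank s1 i
    else if i - size s1 < size s2 then nth blank s2 (i - size s1)
    else nth blank s3 (i - size s1 - size s2) by rewrite !nth_cat.
rewrite /GC /target !nth3 !size_pad => ilt /=.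
case: ltnP => iL; first by constructor 1; split;
  [|apply: (@mem_pad (size (GL D)))]; rewrite mem_nth ?size_pad.
case: ltnP => iN; first by constructor 2; split;
  [|apply: (@mem_pad (size (GN D)))]; rewrite mem_nth ?size_pad.
by constructor 3; rewrite nth_nseq if_same.
Qed.

Section TargetRepair.
Variable t : 'I_(size (GC D)) -> rule.

(** A head change is recorded at every position, even when it changes nothing. Literals are recorded
    only where the bodies differ, since a valid repair adds only absent literals and deletes only
    present ones. *)
Definition requires (x : 'I_(size (GC D)) * change T Q) : bool :=
  match x.2 with
  | ChangeHead h => h == hd (t x.1)
  | AddLit l => (l \in bd (t x.1)) && (l \notin bd (rule_at x.1))
  | DelLit l => (l \notin bd (t x.1)) && (l \in bd (rule_at x.1))
  end.

Definition target_changes (i : 'I_(size (GC D))) :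
    seq ('I_(size (GC D)) * change T Q) :=
  (i, ChangeHead (hd (t i))) ::
  [seq (i, AddLit l) | l <- enum_fset (bd (t i) `\` bd (rule_at i))%fset] ++
  [seq (i, DelLit l) | l <- enum_fset (bd (rule_at i) `\` bd (t i))%fset].

Definition target_repair : change_set D :=
  [fset x in flatten [seq target_changes i | i <- enum 'I_(size (GC D))]]%fset.

Lemma target_repairE x : (x \in target_repair) = requires x.
Proof.
rewrite inE /=; case: x => i c; apply/flatten_mapP/idP => [[j _]|].
  rewrite inE mem_cat => /or3P[/eqP[-> ->]|/mapP[l]|/mapP[l]].
  - by rewrite /requires /=.
  - by move=> lb [-> ->]; move: lb; rewrite in_fsetD andbC.
  - by move=> lb [-> ->]; move: lb; rewrite in_fsetD.
move=> req; exists i; first exact: mem_enum.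
rewrite inE mem_cat; case: c req => [h|l|l] /=; rewrite /requires /=.
- by move=> /eqP->; rewrite eqxx.
- by move=> lb; rewrite [X in _ || (X || _)]map_f ?orbT // in_fsetD andbC.
- by move=> lb; rewrite [X in _ || (_ || X)]map_f ?orbT // in_fsetD.
Qed.

Lemma added_target i l : (l \in added target_repair i) = requires (i, AddLit l).
Proof.
rewrite inE /= -target_repairE mem_pmap; apply/mapP/idP => [[[j []] //= l']|iX].
  by move=> jX; case: eqP => // <- [->].
by exists (i, AddLit l) => //=; rewrite eqxx.
Qed.

Lemma deleted_target i l :
  (l \in deleted target_repair i) = requires (i, DelLit l).
Proof.
rewrite inE /= -target_repairE mem_pmap; apply/mapP/idP => [[[j []] //= l']|iX].
  by move=> jX; case: eqP => // <- [->].
by exists (i, DelLit l) => //=; rewrite eqxx.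
Qed.

(** Only the first entry of [head_changes] counts. All entries equal [hd (t i)] and there is at
    least one, so the default, the old head, is never taken. *)
Lemma repaired_head_target i : repaired_head target_repair i = hd (t i).
Proof.
have mem_hc h : (h \in head_changes target_repair i) = (h == hd (t i)).
  rewrite -[RHS](target_repairE (i, ChangeHead h)) mem_pmap.
  apply/mapP/idP => [[[j []] //= h']|iX].
    by move=> jX; case: eqP => // <- [->].
  by exists (i, ChangeHead h) => //=; rewrite eqxx.
rewrite /repaired_head; case eqs: (head_changes _ i) => [|h s] /=.
  by have := mem_hc (hd (t i)); rewrite eqs eqxx.
by apply/eqP; rewrite -mem_hc eqs mem_head.
Qed.

(** A repaired rule with head ∅ has empty body by definition, whence the condition on [t i]. *)
Lemma repaired_rule_target i :
  (hd (t i) = None -> bd (t i) = fset0) ->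
  repaired_rule target_repair i = t i.
Proof.
move=> blank_t; rewrite /repaired_rule repaired_head_target.
rewrite [RHS]surjective_pairing; congr pair.
case eqh: (hd (t i)) => [h|]; last by rewrite -blank_t.
apply/fsetP => l; rewrite in_fsetD in_fsetU added_target deleted_target /requires /=.
by change (t i).2 with (bd (t i)); case: (l \in bd (t i)); case: (l \in _).
Qed.

End TargetRepair.

End Retarget.

(** * Validity of the repair when [ls] are legal facts and [ns] are next rules guarded by moves *)

Section TargetValid.
Context {T Q : choiceType}.
Local Notation atom := (atom T Q).
Local Notation rule := (rule T Q).
Variable D : decomposition T Q.
Local Notation G := (program D).
Variables ls ns : seq rule.
Hypotheses (restrictedG : restricted_form G) (decG : is_decomposition D).
Hypothesis lsP : forall r, r \in ls ->
  has_head_in r (legal_atoms G) /\ bd r = fset0.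
Hypothesis nsP : forall r, r \in ns ->
  has_head_in r (next_atoms G) /\ forall l, l \in bd r -> action_literals G l.

Definition target_rule (i : 'I_(size (GC D))) : rule :=
  nth blank (target D ls ns) i.

Lemma legal_next_disjoint (r : rule) :
  has_head_in r (legal_atoms G) -> has_head_in r (next_atoms G) -> False.
Proof.
by case=> h hr [p [a [_ hE]]] [h' hr' [f _ h'E]]; move: hr'; rewrite hr hE -h'E.
Qed.

Lemma target_ruleP i :
  [\/ rule_at i \in GL D /\ (target_rule i \in ls \/ target_rule i = blank),
      rule_at i \in GN D /\ (target_rule i \in ns \/ target_rule i = blank) |
      rule_at i = blank].
Proof.
by rewrite /rule_at (tnth_nth blank); exact: (nth_target ls ns (ltn_ord i)).
Qed.

Lemma mem_target_rule i :
  [\/ target_rule i \in ls, target_rule i \in ns | target_rule i = blank].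
Proof. by apply: (@mem_target _ _ D); rewrite mem_nth ?size_target. Qed.

Lemma target_rule_body i l : l \in bd (target_rule i) -> target_rule i \in ns.
Proof.
case: (mem_target_rule i) => // [/lsP[_ ->]|->]; by rewrite in_fset0.
Qed.

Lemma mem_program_GL r : r \in GL D -> r \in G.
Proof. by rewrite /program /GC !mem_cat => ->. Qed.

Lemma mem_program_GN r : r \in GN D -> r \in G.
Proof. by rewrite /program /GC !mem_cat => ->; rewrite !orbT. Qed.

Lemma mem_program_GR r : r \in GR D -> r \in G.
Proof. by rewrite /program mem_cat => ->; rewrite orbT. Qed.

Lemma mem_program r : r \in G ->
  [\/ r \in GL D, r \in GN D, r = blank | r \in GR D].
Proof.
rewrite /program /GC !mem_cat -!orbA mem_nseq => /or4P[|||].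
- by constructor 1.
- by constructor 2.
- by case/andP => _ /eqP; constructor 3.
- by constructor 4.
Qed.

Lemma valid_target_repair : valid_repair (target_repair target_rule).
Proof.
split.
- move=> i [h|l|l]; rewrite target_repairE /requires /=.
  + move=> /eqP->; case: (mem_target_rule i) => [/lsP[[h' -> lh] _]|/nsP[[h' -> nh] _]|->] //.
      by left.
    by right.
  + by case/andP => lt _; left; exact: (nsP (target_rule_body lt)).2 lt.
  (* Deleted literals come from old legal or next rules, whose bodies the restricted form confines
     to the domain of changes. *)
  + case/andP => _; case: (target_ruleP i) => [[rL _] lr|[rN _]|->].
    * right; apply: (restricted_legal_rule restrictedG) lr.
        exact: mem_program_GL.
      exact: (decomposition_GL decG).
    * move=> lr; apply: (restricted_next_rule restrictedG) lr.
        exact: mem_program_GN.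
      exact: (decomposition_GN decG).
    * by rewrite in_fset0.
- by move=> i h h'; rewrite !target_repairE /requires /= => /eqP-> /eqP->.
- move=> i l; rewrite added_target => /andP[/= lt ->]; split=> //.
  by left; exact: (nsP (target_rule_body lt)).2 lt.
- by move=> i l; rewrite deleted_target => /andP[].
- move=> i h rL; rewrite target_repairE /requires /= => /eqP hE.
  have lr := decomposition_GL decG rL.
  case: (target_ruleP i) => [[_ [/lsP[[h' h'E ?] _]|tb]]|[rN _]|rb].
  + by move: hE; rewrite h'E => -[->].
  + by move: hE; rewrite tb.
  + by case: (legal_next_disjoint lr (decomposition_GN decG rN)).
  + by case: lr; rewrite rb.
- move=> i h rN; rewrite target_repairE /requires /= => /eqP hE.
  have nr := decomposition_GN decG rN.
  case: (target_ruleP i) => [[rL _]|[_ [/nsP[[h' h'E ?] _]|tb]]|rb].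
  + by case: (legal_next_disjoint (decomposition_GL decG rL) nr).
  + by move: hE; rewrite h'E => -[->].
  + by move: hE; rewrite tb.
  + by case: nr; rewrite rb.
(* An added literal forces the target rule into [ns]. Its head is then a next atom, and the old rule
   is not in [GL], so neither the new nor the old head can be a legal atom. *)
- move=> i lr l; rewrite added_target => /andP[/= lt _].
  have [nt _] := nsP (target_rule_body lt).
  case: lr => [lr|[h]]; last first.
    rewrite target_repairE /requires /= => /eqP hE lh.
    by case: (@legal_next_disjoint (target_rule i)) => //; exists h.
  case: (target_ruleP i) => [[_ [/lsP[_ tb]|tb]]|[rN _]|rb].
  + by move: lt; rewrite tb in_fset0.
  + by move: lt; rewrite tb in_fset0.
  + by case: (legal_next_disjoint lr (decomposition_GN decG rN)).
  + by case: lr; rewrite rb.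
Qed.

Lemma rep_target : rep (target_repair target_rule) = target D ls ns ++ GR D.
Proof.
rewrite /rep; congr cat; rewrite -[RHS](mkseq_nth blank) size_target /mkseq.
rewrite -val_enum_ord -map_comp; apply: eq_map => i.
rewrite repaired_rule_target //.
case: (mem_target_rule i) => [/lsP[[h -> _]]|/nsP[[h -> _]]|->] //.
Qed.

End TargetValid.

(** * The rules of the one-round game *)

Section OneStepGame.
Context {T Q : choiceType}.
Local Notation atom := (atom T Q).
Local Notation literal := (literal T Q).
Local Notation rule := (rule T Q).
Variable D : decomposition T Q.
Local Notation G := (program D).
Hypotheses (validG : valid_gdl G) (restrictedG : restricted_form G).
Hypothesis decG : is_decomposition D.

Variables (qs : seq T) (z : T) (a0 a1 : T -> T) (W : T -> set T).
Hypothesis uniq_players : uniq (rcons qs z).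
Hypothesis playersP : forall p, (p \in rcons qs z) <-> players G p.
Hypothesis a0P : forall p, players G p -> move_domain G p (a0 p).
Hypothesis a1P : forall p, players G p -> move_domain G p (a1 p).
Hypothesis a01 : forall p, players G p -> a0 p <> a1 p.
Hypothesis WP : forall p, players G p ->
  [/\ is_state G (W p), holds_in G (W p) (AGoal p 100) &
      holds_in G (W p) ATerminal].
Hypothesis init_not_terminal : ~ holds_in G (init_state G) ATerminal.

Definition winner (A : T -> T) : T :=
  foldr (fun q w => if A q == a1 q then q else w) z qs.

Lemma foldr_winner A s :
  foldr (fun q w => if A q == a1 q then q else w) z s \in rcons s z.
Proof.
elim: s => [|q s IH] /=; first by rewrite mem_head.
by case: ifP; rewrite inE ?eqxx // IH orbT.
Qed.

Lemma winner_player A : players G (winner A).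
Proof. by apply/playersP; exact: foldr_winner. Qed.

(** For the last player [z], who is not in [qs], [index z qs] is the length of [qs]: the guard then
    says that nobody in [qs] plays [a1], and has no positive literal. *)
Definition guard (p : T) : {fset literal} :=
  [fset l in [seq Neg (ADoes q (a1 q)) | q <- take (index p qs) qs] ++
     (if p \in qs then [:: Pos (ADoes p (a1 p))] else [::])]%fset.

Lemma Neg_guard p a : reflect
  (exists2 q, q \in take (index p qs) qs & a = ADoes q (a1 q))
  (Neg a \in guard p).
Proof.
rewrite !inE /= orbC; case: ifP => _ /=; rewrite ?inE /=;
  by apply: (iffP mapP) => -[q qp]; exists q => //; congruence.
Qed.

Lemma Pos_guard p a : Pos a \in guard p = (p \in qs) && (a == ADoes p (a1 p)).
Proof.
rewrite !inE /=; case: mapP => [[]//|_] /=.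
by case: ifP => // _; rewrite inE; apply/eqP/eqP => [[]|->].
Qed.

(** The left side is the truth of [guard p] under the joint action [A]; hence exactly one guard
    holds for each joint action. *)
Lemma winnerP A p : p \in rcons qs z ->
  ((forall q, q \in take (index p qs) qs -> A q <> a1 q) /\
   (p \in qs -> A p = a1 p)) <-> p = winner A.
Proof.
rewrite /winner; elim: (qs) (uniq_players) => [_|q s IH] /=.
  by rewrite inE => /eqP->.
rewrite inE => /andP[qs' /IH{}IH].
case: (eqVneq p q) => [->|pq] /= => [_|ps].
  rewrite mem_head; case: eqP => [Aq|nAq].
    by split.
  split=> [[_ /(_ isT)//]|qE].
  (* A player who declines [a1] cannot win later, because the enumeration lists nobody twice. *)
  by move: qs'; rewrite qE foldr_winner.
rewrite inE (negbTE pq) /=.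
case: eqP => [Aq|nAq].
  split=> [[/(_ q)]|]; first by rewrite mem_head => /(_ isT).
  by move=> pE; rewrite pE eqxx in pq.
rewrite -IH //; split=> -[negA posA]; split=> // x.
  by move=> xs; apply: negA; rewrite inE xs orbT.
by rewrite inE => /orP[/eqP->|/negA].
Qed.

Definition legal_facts : seq rule :=
  [seq fact (ALegal p (a0 p)) | p <- rcons qs z] ++
  [seq fact (ALegal p (a1 p)) | p <- rcons qs z].

(** Filtering all pairs of a player and a next atom gives the bound by the number of such pairs at
    once. Membership in [W] is decided classically. *)
Definition next_facts : seq rule :=
  [seq (Some x.2, guard x.1) |
     x <- [seq (p, h) | p <- rcons qs z, h <- enum_fset (fset_set (next_atoms G))]
     & `[<exists2 f, W x.1 f & x.2 = ANext f>]].

Lemma size_legal_facts : size legal_facts = 2 * size (rcons qs z).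
Proof. by rewrite size_cat !size_map mul2n addnn. Qed.

Lemma size_next_facts :
  size next_facts <= #|` fset_set (next_atoms G)| * size (rcons qs z).
Proof.
rewrite size_map size_filter mulnC.
by apply: leq_trans (count_size _ _) _; rewrite size_allpairs.
Qed.

Lemma legal_factsP r : r \in legal_facts <->
  exists2 p, players G p & r = fact (ALegal p (a0 p)) \/ r = fact (ALegal p (a1 p)).
Proof.
rewrite mem_cat; split=> [/orP[]/mapP[p /playersP pp ->]|[p /playersP pp]].
- by exists p => //; left.
- by exists p => //; right.
- by case=> ->; apply/orP; [left|right]; apply: map_f.
Qed.

Lemma next_factsP r : r \in next_facts <->
  exists p f, [/\ players G p, W p f & r = (Some (ANext f), guard p)].
Proof.
split=> [/mapP[[p h]]|[p [f [pp Wf ->]]]].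
  rewrite mem_filter => /andP[/asboolP/= [f Wf ->]].
  case/allpairsP=> -[q h'] /= [/playersP qp _ [pq _]] ->.
  by exists p, f; split=> //; rewrite pq.
apply/mapP; exists (p, ANext f) => //; rewrite mem_filter; apply/andP; split.
  by apply/asboolP; exists f.
apply/allpairsP; exists (p, ANext f); split=> //=; first exact/playersP.
rewrite in_fset_set; last exact: finite_next_atoms.
by apply/mem_set; exists f => //; have [Wb _ _] := WP pp; exact: Wb.
Qed.

Lemma legal_facts_legal r : r \in legal_facts ->
  has_head_in r (legal_atoms G) /\ bd r = fset0.
Proof.
case/legal_factsP => p pp [] ->; split=> //.
  by exists (ALegal p (a0 p)) => //; exists p, (a0 p); split=> //; exact: a0P.
by exists (ALegal p (a1 p)) => //; exists p, (a1 p); split=> //; exact: a1P.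
Qed.

Lemma qs_player p : p \in qs -> players G p.
Proof. by move=> pq; apply/playersP; rewrite mem_rcons inE pq orbT. Qed.

Lemma next_facts_next r : r \in next_facts ->
  has_head_in r (next_atoms G) /\ forall l, l \in bd r -> action_literals G l.
Proof.
case/next_factsP => p [f [pp Wf ->]]; split.
  by exists (ANext f) => //; exists f => //; have [Wb _ _] := WP pp; exact: Wb.
case=> a /=.
  rewrite Pos_guard => /andP[pq /eqP->]; exists p, (a1 p); split; last by left.
  exact: a1P.
case/Neg_guard=> q /mem_take/qs_player qp ->; exists q, (a1 q); split; last by right.
exact: a1P.
Qed.

(** * The repaired program and its agreement with the original one *)

Hypothesis legal_rules : 2 * size (rcons qs z) <= size (GL D) + size (GE D).
Hypothesis next_rules : #|` fset_set (next_atoms G)| * size (rcons qs z)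
  <= size (GN D) + size (GE D).
Hypothesis all_rules : (2 + #|` fset_set (next_atoms G)|) * size (rcons qs z)
  <= size (GL D) + size (GN D) + size (GE D).

(** The repaired program, in the form that [rep_target] yields. *)
Definition game : seq rule := target D legal_facts next_facts ++ GR D.

Lemma mem_game r : r \in game ->
  [\/ r \in legal_facts, r \in next_facts, r = blank | r \in GR D].
Proof.
rewrite mem_cat => /orP[/mem_target[]|];
  by [constructor 1|constructor 2|constructor 3|constructor 4].
Qed.

Lemma game_facts r : r \in legal_facts ++ next_facts -> r \in game.
Proof.
move=> rf; rewrite mem_cat; apply/orP; left; apply: sub_target rf.
- by rewrite size_legal_facts.
- exact: leq_trans size_next_facts next_rules.
- apply: leq_trans all_rules; rewrite mulnDl size_legal_facts leq_add2l.
  exact: size_next_facts.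
Qed.

(** These atoms form the splitting set: both programs have the same rules for them, and no body in
    the original program leaves the set. *)
Definition internal (a : atom) : Prop := pred_of a <> PLegal /\ pred_of a <> PNext.

Definition inputs (F : set rule) : Prop :=
  forall r, F r -> exists2 a, r = fact a & pred_of a = PTrue \/ pred_of a = PDoes.

Lemma internal_rules r h : hd r = Some h -> internal h -> r \in G <-> r \in game.
Proof.
move=> hr [hL hN]; split.
  case/mem_program=> [/(decomposition_GL decG)|/(decomposition_GN decG)|rE|rR].
  - case=> h' + [p [a [_ h'E]]]; rewrite hr => -[hh].
    by case: hL; rewrite hh h'E.
  - case=> h' + [f _ h'E]; rewrite hr => -[hh].
    by case: hN; rewrite hh -h'E.
  - by rewrite rE in hr.
  - by rewrite /game mem_cat rR orbT.
case/mem_game => [/legal_factsP[p _ rE]|/next_factsP[p [f [_ _ rE]]]|rE|].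
- by case: rE hr => -> [hE]; case: hL; rewrite -hE.
- by move: hr; rewrite rE => -[hE]; case: hN; rewrite -hE.
- by rewrite rE in hr.
- exact: mem_program_GR.
Qed.

Lemma internal_body r l : r \in G -> l \in bd r -> internal (lit_atom l).
Proof.
move=> rG lr; split=> lE.
  by case: (restricted_no_legal restrictedG rG); exists l.
by case: (valid_init_next validG rG) => _; case; exists l.
Qed.

(* [does] heads no rule, so it may be moved to the lowest stratum; this makes
   room for the new [next] rules, whose bodies mention it negatively. *)
Definition level (str : pred_symbol Q -> nat) (a : atom) : nat :=
  if a is ADoes _ _ then 0 else (str (pred_of a)).+1.

(** Comparing the two programs by [entails_agree] calls for a single level function that stratifies
    both. *)
Lemma exists_level : exists lev, forall F, inputs F ->
  stratified_by lev ([set` G] `|` F) /\ stratified_by lev ([set` game] `|` F).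
Proof.
have [str strP] := valid_stratified validG; exists (level str) => F inF.
have strG r h : r \in G -> hd r = Some h ->
    (forall a, Pos a \in bd r -> level str a <= level str h) /\
    (forall a, Neg a \in bd r -> level str a < level str h).
  move=> rG hr; have [pos neg] := strP r h rG hr.
  (* No rule of [G] has a [does] atom as head, so lowering the level of these atoms affects bodies
     only. *)
  have hE : level str h = (str (pred_of h)).+1.
    case: h hr {pos neg} => // p a hr.
    by case: (valid_true_does validG rG) => _; case; exists (ADoes p a).
  rewrite hE; split=> a /[dup] ar; [move/pos|move/neg]; case: a ar => //=.
have strF r h : F r -> hd r = Some h ->
    (forall a, Pos a \in bd r -> level str a <= level str h) /\
    (forall a, Neg a \in bd r -> level str a < level str h).
  by move=> /inF[a -> _] _; split=> b; rewrite in_fset0.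
split=> r h [] // rG hr; [exact: strG | exact: strF | | exact: strF].
case: (mem_game rG) => [/legal_facts_legal[_ ->]|/next_factsP|rE|rR].
- by split=> a; rewrite in_fset0.
- case=> p [f [_ _ rE]]; move: hr; rewrite rE => -[<-] /=; split=> a.
    by rewrite Pos_guard => /andP[_ /eqP->].
  by case/Neg_guard => q _ ->.
- by rewrite rE in hr.
- by apply: strG hr; exact: mem_program_GR.
Qed.

Lemma entails_game F q : inputs F -> internal q ->
  entails ([set` G] `|` F) q <-> entails ([set` game] `|` F) q.
Proof.
move=> inF intq; have [lev /(_ F inF)[strG strG']] := exists_level.
apply: (entails_agree strG strG') intq => [r h hr inth|r h [rG|/inF[a -> _]] hr inth l].
- by split=> -[/(internal_rules hr inth) rG|Fr]; by [left | right].
- exact: internal_body.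
- by rewrite in_fset0.
Qed.

Lemma inputs0 : inputs set0. Proof. by []. Qed.

Lemma inputs_true S : inputs (true_facts S).
Proof. by move=> r [f _ <-]; exists (ATrue f) => //; left. Qed.

Lemma inputs_does S A : inputs (true_facts S `|` does_facts game A).
Proof.
move=> r [/inputs_true//|[p _ <-]].
by exists (ADoes p (A p)) => //; right.
Qed.

Lemma entails_game0 q : internal q -> entails [set` G] q <-> entails [set` game] q.
Proof. by move=> intq; have := entails_game inputs0 intq; rewrite !setU0. Qed.

Lemma base_game : base_props game = base_props G.
Proof. by apply/seteqP; split=> f /entails_game0; apply. Qed.

Lemma players_game : players game = players G.
Proof. by apply/seteqP; split=> p /entails_game0; apply. Qed.

Lemma moves_game p : move_domain game p = move_domain G p.
Proof. by apply/seteqP; split=> a /entails_game0; apply. Qed.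

Lemma init_game : init_state game = init_state G.
Proof.
rewrite /init_state base_game.
by apply/seteqP; split=> f [fb /entails_game0 fi]; split=> //; apply: fi.
Qed.

Lemma holds_game S q : internal q -> holds_in G S q <-> holds_in game S q.
Proof. exact/entails_game/inputs_true. Qed.

Lemma terminal_game S :
  terminal_states game S <-> is_state G S /\ holds_in G S ATerminal.
Proof. by rewrite holds_game // /terminal_states /= /is_state base_game. Qed.

(** * Moves, successor states and plays of the repaired game *)

Lemma legal_game S p a : players G p -> a = a0 p \/ a = a1 p -> legal_in game S p a.
Proof.
move=> pp aE; have [lev /(_ _ (inputs_true (S := S)))[_ str]] := exists_level.
have [M sM] := stable_exists str; apply/(entailsE _ str sM).
case: sM => MM _; apply: (MM (fact (ALegal p a))) => //;
    try by move=> b; rewrite in_fset0.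
left; apply: game_facts; rewrite mem_cat; apply/orP; left; apply/legal_factsP.
by exists p => //; case: aE => ->; [left|right].
Qed.

(** The [does] atoms of the stable model are exactly the facts given by [A], so by [winnerP] the
    only next rules that fire are those guarded for the winner. Neither [S] nor the legality of [A]
    matters. *)
Lemma update_game S A : update game A S = W (winner A).
Proof.
have [lev /(_ _ (inputs_does (S := S) (A := A)))[_ str]] := exists_level.
have [M sM] := stable_exists str.
have nextE f : base_props game f /\
    entails ([set` game] `|` true_facts S `|` does_facts game A) (ANext f) <->
    base_props G f /\ M (ANext f).
  by rewrite base_game -setUA (entailsE _ str sM).
have doesE p a : M (ADoes p a) <-> players G p /\ a = A p.
  split=> [/(stable_supported sM)[r [+ hr _ _]]|[pp ->]].
    case=> [rG|[[f _ rE]|[q qp rE]]].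
    - have rG' : r \in G by apply/(internal_rules hr).
      by case: (valid_true_does validG rG') => _; case; exists (ADoes p a).
    - by move: hr; rewrite -rE.
    - by rewrite -players_game; move: hr; rewrite -rE => -[<- <-].
  case: sM => MM _; apply: (MM (fact (ADoes p (A p)))) => //;
    try by move=> b; rewrite in_fset0.
  by right; right; exists p => //; rewrite players_game.
apply/seteqP; split=> f.
  case/nextE => fb /(stable_supported sM)[r [+ hr neg pos]].
  case=> [/mem_game rG|[[g _ rE]|[q _ rE]]]; [|by move: hr; rewrite -rE..].
  case: rG => [/legal_factsP[p _ [] rE]|/next_factsP|rE|/(decomposition_GR decG)[_ _]].
  - by rewrite rE in hr.
  - by rewrite rE in hr.
  - case=> p [g [pp Wg rE]]; move: hr; rewrite rE => -[<-].
    suff <- : p = winner A by [].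
    apply/winnerP; first exact/playersP.
    split=> [q qp Aq|pq].
      have := neg (ADoes q (a1 q)); rewrite rE; apply.
        by apply/Neg_guard; exists q.
      by apply/doesE; split=> //; apply/qs_player/(mem_take qp).
    have := pos (ADoes p (a1 p)); rewrite rE Pos_guard pq eqxx => /(_ isT).
    by case/doesE.
  - by rewrite rE in hr.
  (* The decomposition keeps out of [GR] only those next heads whose proposition is a base
     proposition; [fb] says that [f] is one. *)
  - by case; exists (ANext f) => //; exists f.
move=> Wf; apply/nextE; have wp := winner_player A.
have [Wb _ _] := WP wp; split; first exact: Wb.
have [negA posA] : _ /\ _ := (winnerP A (proj2 (playersP _) wp)).2 erefl.
case: sM => MM _; apply: (MM (Some (ANext f), guard (winner A))) => //.
- left; apply: game_facts; rewrite mem_cat; apply/orP; right; apply/next_factsP.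
  by exists (winner A), f.
- by move=> b /Neg_guard[q qw ->] /doesE[_ Aq]; exact: (negA q).
- move=> b; rewrite Pos_guard => /andP[wq /eqP->]; apply/doesE; split=> //.
  by rewrite posA.
Qed.

(** A joint action that lets [p] win, the last player included: nobody else plays [a1]. *)
Definition challenge (p q : T) : T := if q == p then a1 q else a0 q.

Lemma winner_challenge p : players G p -> winner (challenge p) = p.
Proof.
move=> /playersP pp; apply/esym/winnerP => //; split=> [q qp|_]; last by rewrite /challenge eqxx.
rewrite /challenge; case: eqP => [qE|_]; last exact/a01/qs_player/(mem_take qp).
(* If [q] were [p], lying before position [index p qs] would give [index p qs < index p qs]. *)
by move: (qp); rewrite in_take ?(mem_take qp) // qE ltnn.
Qed.

Lemma terminal_W p : players G p -> terminal_states game (W p).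
Proof. by move=> /WP[Wb _ Wt]; apply/terminal_game. Qed.

Lemma init_not_terminal_game : ~ terminal_states game (init_state game).
Proof. by move/terminal_game; rewrite init_game => -[]. Qed.

Lemma playable_game S : ~ non_playable_states game S.
Proof.
case=> _ [p]; rewrite players_game => pp /(_ (a1 p)); apply.
  by rewrite moves_game; exact: a1P.
by apply: legal_game => //; right.
Qed.

(** Every successor state is some [W p], which is terminal, so no second step is possible. *)
Lemma terminal_step m s : valid_sequence game m s -> 0 < m ->
  m = 1 /\ terminal_states game (s m).
Proof.
case=> _ step m0; have ts1 : terminal_states game (s 1).
  by have [_ [A _ ->]] := step 0 m0; rewrite update_game; exact/terminal_W/winner_player.
case: m m0 step => [|[|m]] // _ step.
by have [nt _] := step 1 isT; case: (nt ts1).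
Qed.

Lemma challenge_sequence p : players G p ->
  valid_sequence game 1 (fun i => if i is 0 then init_state game else W p).
Proof.
move=> pp; split=> // -[|//] _; split; first exact: init_not_terminal_game.
exists (challenge p); last by rewrite update_game winner_challenge.
move=> q; rewrite players_game => qp; apply: legal_game => //.
by rewrite /challenge; case: eqP; [right|left].
Qed.

Lemma well_formed_game : well_formed game.
Proof.
split.
- move=> p; rewrite players_game => pp.
  exists 1, (fun i => if i is 0 then init_state game else W p).
  split; [exact: challenge_sequence | exact: terminal_W |].
  by apply/holds_game => //; have [] := WP pp.
- by move=> m s _ [/playable_game].
- split=> [s /(_ 2)/terminal_step[]//|m s [vs ext]].
  case: m vs ext => [|m] vs ext; last exact: (terminal_step vs isT).2.
  have /playersP zp : z \in rcons qs z by rewrite mem_rcons mem_head.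
  (* A play cannot stop at the initial state, since the challenge of [z] extends it by one step. *)
  case: ext; exists (fun i => if i is 0 then init_state game else W z).
  by split=> [|[]//]; [exact: challenge_sequence | case: vs].
Qed.

Lemma horizon_bound_game : horizon_bound game 1.
Proof.
move=> m s [vs [mE|[+ [ts|/playable_game//]]]].
  by constructor 1; have [] := terminal_step vs; rewrite mE.
by constructor 1.
Qed.

(** The horizon is the least bound; it exists because 1 is a bound, and is therefore at most 1. *)
Lemma n_well_formed_game n : 0 < n -> n_well_formed n game.
Proof.
move=> n0; split; first exact: well_formed_game.
have ex : exists k, `[<horizon_bound game k>].
  by exists 1; apply/asboolP/horizon_bound_game.
case: (ex_minnP ex) => h /asboolP hh min; exists h; last first.
  by apply: leq_trans n0; apply/min/asboolP/horizon_bound_game.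
by split=> // k /asboolP /min.
Qed.

End OneStepGame.

(** * Choice of winning states and moves, and assembly of the repair *)

Theorem theorem2 (T Q : choiceType) (D : decomposition T Q)
  (G := program D)
  (validG : valid_gdl G)
  (restrictedG : restricted_form G)
  (decG : is_decomposition D)
  (players_nonempty : players G !=set0)
  (init_not_terminal : ~ holds_in G (init_state G) ATerminal)
  (two_moves : forall p, players G p -> 2 <= #|` fset_set (move_domain G p)|)
  (goal_states : forall p, players G p ->
     exists S : set T, [/\ is_state G S, holds_in G S (AGoal p 100) &
                           holds_in G S ATerminal])
  (legal_rules : 2 * #|` fset_set (players G)| <= size (GL D) + size (GE D))
  (next_rules : #|` fset_set (next_atoms G)| * #|` fset_set (players G)|
                <= size (GN D) + size (GE D))
  (all_rules : (2 + #|` fset_set (next_atoms G)|) * #|` fset_set (players G)|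
               <= size (GL D) + size (GN D) + size (GE D)) :
  forall n : nat, 0 < n ->
    exists X : change_set D, valid_repair X /\ n_well_formed n (rep X).
Proof.
move=> n n0; have [p0 p0G] := players_nonempty.
have playersP p : (p \in enum_fset (fset_set (players G))) <-> players G p.
  by rewrite (in_fset_set (finite_players G)); split; [exact: set_mem | exact: mem_set].
have [W WP] : exists W : T -> set T, forall p, players G p ->
    [/\ is_state G (W p), holds_in G (W p) (AGoal p 100) &
        holds_in G (W p) ATerminal].
  have [|W WP] := @choice T (set T) (fun p S => players G p ->
      [/\ is_state G S, holds_in G S (AGoal p 100) & holds_in G S ATerminal]).
    move=> p; have [/goal_states[S SP]|np] := pselect (players G p); first by exists S.
    by exists set0.
  by exists W.
have [m mP] : exists m : T -> T * T, forall p, players G p ->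
    [/\ move_domain G p (m p).1, move_domain G p (m p).2 & (m p).1 <> (m p).2].
  have [|m mP] := @choice T (T * T)%type (fun p m => players G p ->
      [/\ move_domain G p m.1, move_domain G p m.2 & m.1 <> m.2]).
    (* Outside the players the choice is arbitrary; [p0] merely inhabits [T]. *)
    move=> p; have [pp|np] := pselect (players G p); last by exists (p0, p0).
    have [a [b [ma mb ab]]] := two_elements (finite_move_domain G p) (two_moves p pp).
    by exists (a, b).
  by exists m.
move: (fset_uniq (fset_set (players G))) playersP legal_rules next_rules all_rules.
(* The enumeration of the players is not empty, so a last player [z] can be split off as the default
   winner. *)
case/lastP: (enum_fset (fset_set (players G)))
  => [_ /(_ p0)[_ /(_ p0G)]//|qs z] uq playersP Lr Nr Ar.
pose a0 p := (m p).1; pose a1 p := (m p).2.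
pose ls := @legal_facts T Q qs z a0 a1; pose ns := next_facts D qs z a1 W.
have a0P p : players G p -> move_domain G p (a0 p) by case/mP.
have a1P p : players G p -> move_domain G p (a1 p) by case/mP.
have a01 p : players G p -> a0 p <> a1 p by case/mP.
have lsP : forall r, r \in ls -> has_head_in r (legal_atoms G) /\ bd r = fset0.
  exact: legal_facts_legal.
have nsP : forall r, r \in ns ->
    has_head_in r (next_atoms G) /\ forall l, l \in bd r -> action_literals G l.
  exact: next_facts_next.
exists (target_repair (@target_rule _ _ D ls ns)); split.
  exact: valid_target_repair.
rewrite rep_target //.
exact: n_well_formed_game.
Qed.
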